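(* The critical discrete functional equation $(DFE_c)$, i.e. $u(x)=\min_{e\in\mathbf E_x}\big(u(\mathrm t(e))+\sigma_c(-e)\big)$ for all $x\in\mathbf V$, admits a solution $u:\mathbf V\to\mathbb R$.
   Context: Network $\Gamma=\bigcup_{\gamma\in\mathcal E}\gamma([0,1])\subset\mathbb R^N$, $\mathcal E$ finite set of regular simple oriented arcs (possibly closed, $\mathcal E^*$ = closed arcs), closed under inversion $\tilde\gamma(s)=\gamma(1-s)$, interiors pairwise disjoint except $\gamma,\tilde\gamma$; vertices $\mathbf V$ = endpoints; $\Gamma$ connected. Hamiltonians $H_\gamma:[0,1]\times\mathbb R\to\mathbb R$, $H_{\tilde\gamma}(s,p)=H_\gamma(1-s,-p)$, continuous, coercive in $p$, quasiconvex in $p$ with $\mathrm{Int}\{H_\gamma(s,\cdot)\le b\}=\{H_\gamma(s,\cdot)<b\}$. $a_\gamma=\max_s\min_pH_\gamma(s,p)$; $c_\gamma$ = least $a$ such that $H_\gamma(s,u')=a$ has a viscosity subsolution in $(0,1)$, continuous on $[0,1]$, with $u(0)=u(1)$; $a_0=\max\{\max_{\gamma\in\mathcal E\setminus\mathcal E^*}a_\gamma,\max_{\gamma\in\mathcal E^*}c_\gamma\}$; assume $s\mapsto\min_pH_\gamma(s,p)$ is constant whenever $a_\gamma=a_0$. Graph $\mathbf X=(\mathbf V,\mathbf E)$ with bijection $\Psi:\mathbf E\to\mathcal E$, $\mathrm o(e)=\Psi(e)(0)$, $\mathrm t(e)=\Psi(e)(1)$, $-e=\Psi^{-1}(\widetilde{\Psi(e)})$,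 $\mathbf E_x=\{e:\mathrm o(e)=x\}$; for $a\ge a_0$, $\sigma_a(e)=\int_0^1\max\{p:H_{\Psi(e)}(t,p)=a\}\,dt$. A subsolution of $(DFE_a)$ is $u$ with $u(\mathrm t(e))-u(\mathrm o(e))\le\sigma_a(e)$ for all $e$; the critical value is $c=\min\{a\ge a_0:(DFE_a)$ admits a subsolution$\}$ (this minimum exists). *)

(* Defs.v *)
From Stdlib Require Import Reals Lra List Relations ClassicalEpsilon.
Open Scope R_scope.

Definition finite_type (A : Type) : Prop := exists l : list A, forall a : A, In a l.

Definition graph_data (V E : Type) (o t : E -> V) (opp : E -> E) : Prop :=
  finite_type V /\ finite_type E /\
  (forall e, opp (opp e) = e) /\
  (forall e, opp e <> e) /\
  (forall e, o (opp e) = t e) /\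
  (forall x : V, exists e, o e = x) /\
  (forall x y : V, clos_refl_trans V (fun a b => exists e, o e = a /\ t e = b) x y).

Definition closed_edge {V E : Type} (o t : E -> V) (e : E) : Prop := o e = t e.

(** * Hamiltonians h : [0,1] x R -> R  (arguments outside [0,1] are irrelevant) *)

Definition in01 (s : R) : Prop := 0 <= s <= 1.

Definition ham_continuous (h : R -> R -> R) : Prop :=
  forall s p, in01 s -> forall eps, eps > 0 -> exists delta, delta > 0 /\
    forall s' p', in01 s' -> Rabs (s' - s) < delta -> Rabs (p' - p) < delta ->
      Rabs (h s' p' - h s p) < eps.

Definition ham_coercive (h : R -> R -> R) : Prop :=
  forall M, exists Rad, forall s p, in01 s -> Rabs p > Rad -> h s p > M.

Definition ham_quasiconvex (h : R -> R -> R) : Prop :=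
  forall s p q l, in01 s -> 0 <= l <= 1 ->
    h s (l * p + (1 - l) * q) <= Rmax (h s p) (h s q).

Definition ham_interior_cond (h : R -> R -> R) : Prop :=
  forall s b p, in01 s ->
    ((exists delta, delta > 0 /\ forall q, Rabs (q - p) < delta -> h s q <= b)
     <-> h s p < b).

Definition is_min_p (h : R -> R -> R) (s m : R) : Prop :=
  (exists p, h s p = m) /\ (forall p, m <= h s p).

Definition is_a_gamma (h : R -> R -> R) (a : R) : Prop :=
  (exists s, in01 s /\ is_min_p h s a) /\
  (forall s m, in01 s -> is_min_p h s m -> m <= a).

Definition cont01 (u : R -> R) : Prop :=
  forall s, in01 s -> forall eps, eps > 0 -> exists delta, delta > 0 /\
    forall s', in01 s' -> Rabs (s' - s) < delta -> Rabs (u s' - u s) < eps.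

Definition visc_subsol (h : R -> R -> R) (a : R) (u : R -> R) : Prop :=
  forall s, 0 < s < 1 ->
  forall (phi dphi : R -> R),
    (forall x, derivable_pt_lim phi x (dphi x)) -> continuity dphi ->
    (exists delta, delta > 0 /\ forall y, 0 < y < 1 -> Rabs (y - s) < delta ->
        u y - phi y <= u s - phi s) ->
    h s (dphi s) <= a.

Definition c_gamma_admissible (h : R -> R -> R) (a : R) : Prop :=
  exists u : R -> R, cont01 u /\ u 0 = u 1 /\ visc_subsol h a u.

Definition is_c_gamma (h : R -> R -> R) (c : R) : Prop :=
  c_gamma_admissible h c /\ forall a, c_gamma_admissible h a -> c <= a.

Definition pmax (h : R -> R -> R) (a t : R) : R :=
  epsilon (inhabits 0) (fun p => h t p = a /\ forall q, h t q = a -> q <= p).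

(* Riemann integral over [0,1] (the integrand is integrable for a >= a0;
   the value 0 in the non-integrable case is never used). *)
Definition int01 (f : R -> R) : R :=
  epsilon (inhabits 0)
    (fun v => exists pr : Riemann_integrable f 0 1, RiemannInt pr = v).

Definition sigma {E : Type} (H : E -> R -> R -> R) (a : R) (e : E) : R :=
  int01 (pmax (H e) a).

Definition DFE_subsol {V E : Type} (o t : E -> V) (H : E -> R -> R -> R)
  (a : R) (u : V -> R) : Prop :=
  forall e, u (t e) - u (o e) <= sigma H a e.

Definition DFE_sol {V E : Type} (o t : E -> V) (opp : E -> E)
  (H : E -> R -> R -> R) (a : R) (u : V -> R) : Prop :=
  forall x : V,
    (exists e, o e = x /\ u x = u (t e) + sigma H a (opp e)) /\
    (forall e, o e = x -> u x <= u (t e) + sigma H a (opp e)).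

(* Main.v *)
(** Call a vertex always tight if every subsolution at the critical level [c] has
    there an incoming edge on which its inequality is an equality.  If some vertex
    [y] is always tight, the largest subsolution vanishing at [y] (the intrinsic
    distance from [y]) is a solution: at any other vertex without incoming tight
    edge it could be raised.  If no vertex is, averaging one slack subsolution per
    vertex gives a subsolution that is strict on every edge.  For [c > a0] it
    remains a subsolution slightly below [c], as [sigma_a] is continuous in [a],
    contradicting minimality.  For [c = a0] an always tight vertex exists outright:
    an edge attaining [a0] either has a constant minimum, whence
    [sigma e + sigma (-e) = 0], or is a loop with [a_gamma < c_gamma = a0]; on such a
    loop [sigma e] and [sigma (-e)] are nonnegative, and if both were positive, then
    at a level slightly below [c_gamma] mixing the largest and the smallest root of
    [H = a] would produce a periodic C^1 subsolution. *)

Require Import Defs.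
From Stdlib Require Import Reals Lra List Relations ClassicalEpsilon.
From Coquelicot Require Import Coquelicot.
Open Scope R_scope.

(** * Functions continuous on the unit interval and their integrals *)

(** Retraction onto [[0,1]]: composing with it turns a function controlled only there into one
    continuous on all of [R]. *)
Definition clamp (s : R) : R := Rmax 0 (Rmin 1 s).

Lemma clamp_in01 s : in01 (clamp s).
Proof.
unfold in01, clamp, Rmax, Rmin.
destruct (Rle_dec 1 s), (Rle_dec 0 _); lra.
Qed.

Lemma clamp_id s : in01 s -> clamp s = s.
Proof.
unfold in01, clamp, Rmax, Rmin; intros Hs.
destruct (Rle_dec 1 s), (Rle_dec 0 _); lra.
Qed.

Lemma clamp_lipschitz s s' : Rabs (clamp s' - clamp s) <= Rabs (s' - s).
Proof.
unfold clamp, Rmax, Rmin.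
destruct (Rle_dec 1 s), (Rle_dec 1 s'); repeat destruct (Rle_dec 0 _);
  unfold Rabs; repeat destruct (Rcase_abs _); lra.
Qed.

Lemma cont01_clamp u : cont01 u -> forall s, continuity_pt (fun s => u (clamp s)) s.
Proof.
intros Hu s; apply continuity_pt_locally; intros eps.
destruct (Hu (clamp s) (clamp_in01 s) eps (cond_pos eps)) as [d [Hd Hu']].
exists (mkposreal d Hd); intros y Hy; apply Hu'; [apply clamp_in01|].
apply Rle_lt_trans with (1 := clamp_lipschitz s y); exact Hy.
Qed.

Lemma cont01_opp_reflect f : cont01 f -> cont01 (fun s => - f (1 - s)).
Proof.
intros Hf s Hs eps Heps.
assert (H1 : in01 (1 - s)) by (unfold in01 in *; lra).
destruct (Hf (1 - s) H1 eps Heps) as [d [Hd Hf']].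
exists d; split; [exact Hd|]; intros s' Hs' Hd'.
replace (- f (1 - s') - - f (1 - s)) with (- (f (1 - s') - f (1 - s))) by ring.
rewrite Rabs_Ropp; apply Hf'; [unfold in01 in *; lra|].
replace (1 - s' - (1 - s)) with (- (s' - s)) by ring; now rewrite Rabs_Ropp.
Qed.

Lemma ex_RInt_clamp f a b : cont01 f -> ex_RInt (fun s => f (clamp s)) a b.
Proof.
intros Hf; apply (ex_RInt_continuous (V := R_CompleteNormedModule)); intros z _.
apply continuity_pt_filterlim, cont01_clamp, Hf.
Qed.

(** [int01] is defined by choice, so its value is usable only once integrability is known; this
    passes to [RInt] of a function continuous everywhere. *)
Lemma int01_clamp f : cont01 f -> int01 f = RInt (fun s => f (clamp s)) 0 1.
Proof.
intros Hf.
assert (Hext : forall x, Rmin 0 1 < x < Rmax 0 1 -> f (clamp x) = f x).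
{ rewrite Rmin_left, Rmax_right by lra; intros x Hx; f_equal; apply clamp_id.
  unfold in01; lra. }
assert (Hex : ex_RInt f 0 1) by (apply (ex_RInt_ext (fun s => f (clamp s)));
  [exact Hext | now apply ex_RInt_clamp]).
rewrite (RInt_ext (V := R_CompleteNormedModule) _ _ _ _ Hext).
unfold int01.
destruct (epsilon_spec (inhabits 0)
  (fun v => exists pr : Riemann_integrable f 0 1, RiemannInt pr = v)) as [pr Hpr].
{ now exists (RiemannInt (ex_RInt_Reals_0 _ _ _ Hex)), (ex_RInt_Reals_0 _ _ _ Hex). }
rewrite <- Hpr; symmetry; apply RInt_Reals.
Qed.

(** Change of variable for reversing an arc: reflection and negation turn the largest roots of one
    orientation into the smallest roots of the other. *)
Lemma int01_opp_reflect f : cont01 f -> int01 (fun s => - f (1 - s)) = - int01 f.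
Proof.
intros Hf.
rewrite (int01_clamp _ (cont01_opp_reflect f Hf)), (int01_clamp f Hf).
pose (g := fun s => f (clamp s)).
rewrite (RInt_ext (V := R_CompleteNormedModule) _ (fun s => scal (-1) (g (-1 * s + 1)))).
- rewrite (RInt_comp_lin (V := R_CompleteNormedModule)).
  + replace (-1 * 0 + 1) with 1 by ring; replace (-1 * 1 + 1) with 0 by ring.
    rewrite <- (opp_RInt_swap (V := R_CompleteNormedModule)); [reflexivity|].
    now apply ex_RInt_clamp.
  + now apply ex_RInt_clamp.
- rewrite Rmin_left, Rmax_right by lra; intros x Hx; unfold g.
  unfold scal; simpl; unfold mult; simpl.
  rewrite !clamp_id by (unfold in01; lra).
  replace (-1 * x + 1) with (1 - x) by ring; ring.
Qed.

Lemma int01_ext f g : cont01 f -> (forall s, in01 s -> f s = g s) -> int01 f = int01 g.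
Proof.
intros Hf Hfg.
assert (Hg : cont01 g).
{ intros s Hs eps Heps; destruct (Hf s Hs eps Heps) as [d [Hd H']].
  exists d; split; [exact Hd|]; intros s' Hs'; rewrite <- !Hfg by assumption; auto. }
rewrite !int01_clamp by assumption; apply RInt_ext; intros x _.
apply Hfg, clamp_in01.
Qed.

(** * Largest roots of a quasiconvex Hamiltonian *)

Section Hamiltonian.

Variable h : R -> R -> R.
Hypothesis h_cont : ham_continuous h.
Hypothesis h_coer : ham_coercive h.
Hypothesis h_qc : ham_quasiconvex h.
Hypothesis h_int : ham_interior_cond h.

Lemma ham_cont_p s p eps : in01 s -> eps > 0 ->
  exists d, d > 0 /\ forall q, Rabs (q - p) < d -> Rabs (h s q - h s p) < eps.
Proof.
intros Hs Heps; destruct (h_cont s p Hs eps Heps) as [d [Hd H]].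
exists d; split; [exact Hd|]; intros q Hq; apply H; [exact Hs| |exact Hq].
rewrite Rminus_diag, Rabs_R0; exact Hd.
Qed.

Lemma ham_min_exists s : in01 s -> exists m, is_min_p h s m.
Proof.
intros Hs; destruct (h_coer (h s 0)) as [Rad HRad].
assert (H0 : 0 <= Rad).
{ destruct (Rle_lt_dec 0 Rad) as [H|H]; [exact H|].
  specialize (HRad s 0 Hs); rewrite Rabs_R0 in HRad; lra. }
destruct (continuity_ab_min (h s) (- Rad) Rad) as [p [Hp _]]; [lra| |].
{ intros p _; apply continuity_pt_locally; intros eps.
  destruct (ham_cont_p s p eps Hs (cond_pos eps)) as [d [Hd H]].
  exists (mkposreal d Hd); exact H. }
exists (h s p); split; [now exists p|]; intros q.
destruct (Rle_lt_dec (Rabs q) Rad) as [Hq|Hq].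
- apply Hp; now apply Rabs_le_between.
- apply Rle_trans with (h s 0); [apply Hp; lra|]; apply Rlt_le, HRad; assumption.
Qed.

Lemma ham_qc_between s p q r : in01 s -> p <= q <= r ->
  h s q <= Rmax (h s p) (h s r).
Proof.
intros Hs [Hpq Hqr].
destruct (Req_dec p r) as [->|Hne].
{ replace q with r by lra; apply Rmax_l. }
replace q with ((r - q) / (r - p) * p + (1 - (r - q) / (r - p)) * r) by (field; lra).
apply h_qc; [exact Hs|]; split.
- apply Rdiv_le_0_compat; lra.
- apply Rmult_le_reg_r with (r - p); [lra|]; unfold Rdiv.
  rewrite Rmult_assoc, Rinv_l; lra.
Qed.

(** The largest root is the supremum of the sublevel set, bounded by coercivity; continuity forces
    the value [a] there. The witness [p0] keeps the set nonempty, so [epsilon] has a genuine value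
    to pick. *)
Lemma pmax_spec a s p0 : in01 s -> h s p0 <= a ->
  h s (pmax h a s) = a /\ p0 <= pmax h a s /\
  forall q, pmax h a s < q -> a < h s q.
Proof.
intros Hs Hp0.
destruct (completeness (fun p => h s p <= a)) as [P [HP1 HP2]].
{ destruct (h_coer a) as [Rad HRad]; exists Rad; intros p Hp.
  destruct (Rle_lt_dec p Rad) as [H|H]; [exact H|].
  assert (a < h s p); [|lra].
  apply HRad; [exact Hs|]; pose proof (Rle_abs p); lra. }
{ now exists p0. }
assert (Hup : forall q, P < q -> a < h s q).
{ intros q Hq; destruct (Rle_lt_dec (h s q) a) as [H|H]; [|exact H].
  specialize (HP1 q H); lra. }
assert (HPa : h s P = a).
{ destruct (Rtotal_order (h s P) a) as [H|[H|H]]; [|exact H|].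
  - destruct (ham_cont_p s P (a - h s P) Hs) as [d [Hd Hd']]; [lra|].
    specialize (Hd' (P + d / 2)); specialize (Hup (P + d / 2)).
    rewrite (Rabs_right (P + d / 2 - P)) in Hd' by lra.
    assert (H1 : d / 2 < d) by lra.
    replace (P + d / 2 - P) with (d / 2) in Hd' by ring.
    apply Hd' in H1; apply Rabs_def2 in H1; lra.
  - destruct (ham_cont_p s P (h s P - a) Hs) as [d [Hd Hd']]; [lra|].
    assert (HP3 : P <= P - d); [|lra].
    apply HP2; intros p Hp.
    destruct (Rle_lt_dec p (P - d)) as [H1|H1]; [exact H1|].
    specialize (HP1 p Hp).
    assert (H2 : Rabs (p - P) < d) by (apply Rabs_def1; lra).
    apply Hd' in H2; apply Rabs_def2 in H2; lra. }
destruct (epsilon_spec (inhabits 0)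
  (fun p => h s p = a /\ forall q, h s q = a -> q <= p)) as [E1 E2].
{ exists P; split; [exact HPa|]; intros q Hq; apply HP1; lra. }
fold (pmax h a s) in E1, E2.
assert (HE : pmax h a s = P).
{ apply Rle_antisym; [apply HP1; lra | apply E2, HPa]. }
rewrite HE; repeat split; [exact HPa | now apply HP1 | exact Hup].
Qed.

(** By quasiconvexity a whole neighbourhood of [p] lies in the sublevel set, and the interior
    condition makes the inequality strict. *)
Lemma lt_below_pmax a s p0 p : in01 s -> h s p0 <= a -> p0 < p < pmax h a s ->
  h s p < a.
Proof.
intros Hs Hp0 Hp.
destruct (pmax_spec a s p0 Hs Hp0) as [HP _].
apply (h_int s a p Hs).
exists (Rmin (p - p0) (pmax h a s - p)); split; [apply Rmin_pos; lra|].
intros q Hq; apply Rabs_def2 in Hq.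
pose proof (Rmin_l (p - p0) (pmax h a s - p)).
pose proof (Rmin_r (p - p0) (pmax h a s - p)).
apply Rle_trans with (1 := ham_qc_between s p0 q (pmax h a s) Hs ltac:(lra)).
apply Rmax_lub; lra.
Qed.

(** [h] is below [a] just left of the largest root and above [a] just right of it; both signs
    survive small changes of [a] and [s] and trap the new root. *)
Lemma pmax_continuous a s eps : in01 s -> (exists p, h s p < a) -> eps > 0 ->
  exists d, d > 0 /\ forall a' s', in01 s' -> Rabs (a' - a) < d ->
    Rabs (s' - s) < d -> Rabs (pmax h a' s' - pmax h a s) < eps.
Proof.
intros Hs [p0 Hp0] Heps.
destruct (pmax_spec a s p0 Hs (Rlt_le _ _ Hp0)) as [HP1 [HP2 HP3]].
set (P := pmax h a s) in *.
assert (HpP : p0 < P) by (destruct HP2 as [H|H]; [exact H | rewrite H in Hp0; lra]).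
(* Half the distance to [p0] keeps [P - e] strictly between [p0] and [P]. *)
pose (e := Rmin eps ((P - p0) / 2)).
assert (He0 : 0 < e) by (apply Rmin_pos; lra).
assert (He1 : e <= eps) by apply Rmin_l.
assert (He2 : e <= (P - p0) / 2) by apply Rmin_r.
assert (Hlo : h s (P - e) < a).
{ apply lt_below_pmax with p0; [exact Hs|lra|]; fold P; lra. }
assert (Hhi : a < h s (P + e)) by (apply HP3; lra).
destruct (h_cont s (P - e) Hs ((a - h s (P - e)) / 2)) as [d1 [Hd1 Hc1]]; [lra|].
destruct (h_cont s (P + e) Hs ((h s (P + e) - a) / 2)) as [d2 [Hd2 Hc2]]; [lra|].
exists (Rmin (Rmin d1 d2) (Rmin ((a - h s (P - e)) / 2) ((h s (P + e) - a) / 2))).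
split; [repeat apply Rmin_pos; lra|].
intros a' s' Hs' Ha Hss.
assert (Hm : forall x y z w t, t < Rmin (Rmin x y) (Rmin z w) ->
  t < x /\ t < y /\ t < z /\ t < w).
{ intros x y z w t; unfold Rmin; repeat destruct (Rle_dec _ _); lra. }
apply Hm in Ha; apply Hm in Hss.
destruct Ha as [_ [_ [Ha1 Ha2]]], Hss as [Hs1 [Hs2 _]].
specialize (Hc1 s' (P - e) Hs' Hs1); specialize (Hc2 s' (P + e) Hs' Hs2).
rewrite Rminus_diag, Rabs_R0 in Hc1, Hc2.
specialize (Hc1 Hd1); specialize (Hc2 Hd2).
apply Rabs_def2 in Hc1; apply Rabs_def2 in Hc2.
apply Rabs_def2 in Ha1; apply Rabs_def2 in Ha2.
assert (Hlo' : h s' (P - e) < a') by lra.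
assert (Hhi' : a' < h s' (P + e)) by lra.
destruct (pmax_spec a' s' (P - e) Hs' (Rlt_le _ _ Hlo')) as [HQ1 [HQ2 _]].
set (Q := pmax h a' s') in *.
assert (HQlo : P - e < Q) by (destruct HQ2 as [H|H]; [exact H | rewrite H in Hlo'; lra]).
(* A root at or beyond [P + e] would, by quasiconvexity from [P - e], force [h s' (P + e) <= a']. *)
assert (HQhi : Q < P + e).
{ destruct (Rlt_le_dec Q (P + e)) as [H|H]; [exact H|].
  pose proof (ham_qc_between s' (P - e) (P + e) Q Hs' ltac:(lra)) as H1.
  assert (Rmax (h s' (P - e)) (h s' Q) <= a') by (apply Rmax_lub; lra); lra. }
apply Rabs_def1; lra.
Qed.

Lemma pmax_cont01 a : (forall s, in01 s -> exists p, h s p < a) -> cont01 (pmax h a).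
Proof.
intros Ha s Hs eps Heps.
destruct (pmax_continuous a s eps Hs (Ha s Hs) Heps) as [d [Hd H]].
exists d; split; [exact Hd|]; intros s' Hs' Hss; apply H; try assumption.
now rewrite Rminus_diag, Rabs_R0.
Qed.

Lemma int01_pmax_continuous m a eps : (forall s, in01 s -> exists p, h s p <= m) ->
  m < a -> eps > 0 ->
  exists d, d > 0 /\ forall a', Rabs (a' - a) < d ->
    Rabs (int01 (pmax h a') - int01 (pmax h a)) < eps.
Proof.
intros Hm Hma Heps.
assert (Hlt : forall b, m < b -> forall s, in01 s -> exists p, h s p < b).
{ intros b Hb s Hs; destruct (Hm s Hs) as [p Hp]; exists p; lra. }
destruct (uniform_continuity_2d_1d' (fun b s => pmax h b (clamp s)) 0 1 a) with
  (eps := mkposreal (eps / 2) ltac:(lra)) as [d Hd].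
{ intros s _ e.
  destruct (pmax_continuous a (clamp s) e (clamp_in01 s) (Hlt a Hma _ (clamp_in01 s))
    (cond_pos e)) as [d [Hd H]].
  exists (mkposreal d Hd); intros b s' Hb Hs'; apply H; [apply clamp_in01|exact Hb|].
  apply Rle_lt_trans with (1 := clamp_lipschitz s s'), Hs'. }
simpl in Hd.
(* The cap [a - m] keeps [a'] above every minimum, so [pmax h a'] is still continuous. *)
exists (Rmin d (a - m)); split; [apply Rmin_pos; [apply cond_pos|lra]|].
intros a' Ha'.
pose proof (Rmin_l d (a - m)); pose proof (Rmin_r d (a - m)).
apply Rabs_def2 in Ha'.
pose proof (pmax_cont01 a (Hlt a Hma)) as Hc.
pose proof (pmax_cont01 a' (Hlt a' ltac:(lra))) as Hc'.
rewrite !int01_clamp by assumption.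
rewrite <- (RInt_minus (V := R_CompleteNormedModule)) by (now apply ex_RInt_clamp).
apply Rle_lt_trans with ((1 - 0) * (eps / 2)); [|lra].
apply abs_RInt_le_const; [lra| |].
- apply (ex_RInt_minus (V := R_NormedModule)); now apply ex_RInt_clamp.
- intros t Ht; apply Rlt_le, (Hd t a t a'); try lra.
  rewrite Rminus_diag, Rabs_R0; apply cond_pos.
Qed.

(** * Hamiltonians with constant minimum *)

Section Flat.

Variable a : R.
Hypothesis h_flat : forall s, in01 s -> is_min_p h s a.

(* A nondegenerate segment of minimizers would have interior points, where
   the interior condition forces [h < a]. *)
Lemma flat_minimizer_unique s p q : in01 s -> h s p = a -> h s q = a -> p = q.
Proof.
intros Hs.
assert (Hlt : forall p q, h s p = a -> h s q = a -> ~ p < q).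
{ clear p q; intros p q Hp Hq Hpq.
  destruct (pmax_spec a s p Hs ltac:(lra)) as [_ [_ HP]].
  assert (q <= pmax h a s).
  { destruct (Rle_lt_dec q (pmax h a s)) as [H|H]; [exact H|]. apply HP in H; lra. }
  pose proof (lt_below_pmax a s p ((p + q) / 2) Hs ltac:(lra) ltac:(lra)) as H1.
  pose proof (proj2 (h_flat s Hs) ((p + q) / 2)); lra. }
intros Hp Hq; destruct (Rtotal_order p q) as [H|[H|H]]; [|exact H|];
  now apply Hlt in H.
Qed.

Lemma flat_pmax s : in01 s -> h s (pmax h a s) = a.
Proof.
intros Hs; destruct (h_flat s Hs) as [[p Hp] _].
apply (pmax_spec a s p Hs); lra.
Qed.

Lemma flat_gt s p : in01 s -> p <> pmax h a s -> a < h s p.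
Proof.
intros Hs Hp; destruct (proj2 (h_flat s Hs) p) as [H|H]; [exact H|].
now contradict Hp; apply (flat_minimizer_unique s); [| |apply flat_pmax].
Qed.

(** At the minimal level no strict sublevel point exists, so [pmax_cont01] does not apply; the
    unique minimizer is trapped instead because [h] exceeds [a] at distance [eps] on either side. *)
Lemma flat_pmax_cont01 : cont01 (pmax h a).
Proof.
intros s Hs eps Heps.
set (P := pmax h a s).
pose proof (flat_gt s (P - eps) Hs ltac:(unfold P; lra)) as Hlo.
pose proof (flat_gt s (P + eps) Hs ltac:(unfold P; lra)) as Hhi.
pose proof (flat_pmax s Hs) as HP; fold P in HP.
pose (e := Rmin ((h s (P - eps) - a) / 2) ((h s (P + eps) - a) / 2)).
assert (He : 0 < e) by (apply Rmin_pos; lra).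
assert (He1 : e <= (h s (P - eps) - a) / 2) by apply Rmin_l.
assert (He2 : e <= (h s (P + eps) - a) / 2) by apply Rmin_r.
destruct (h_cont s (P - eps) Hs e He) as [d1 [Hd1 Hc1]].
destruct (h_cont s (P + eps) Hs e He) as [d2 [Hd2 Hc2]].
destruct (h_cont s P Hs e He) as [d3 [Hd3 Hc3]].
exists (Rmin d1 (Rmin d2 d3)); split; [repeat apply Rmin_pos; lra|].
intros s' Hs' Hss.
assert (Hm : forall x y z t, t < Rmin x (Rmin y z) -> t < x /\ t < y /\ t < z).
{ intros x y z t; unfold Rmin; repeat destruct (Rle_dec _ _); lra. }
apply Hm in Hss; destruct Hss as [Hs1 [Hs2 Hs3]].
specialize (Hc1 s' (P - eps) Hs' Hs1); specialize (Hc2 s' (P + eps) Hs' Hs2).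
specialize (Hc3 s' P Hs' Hs3).
rewrite Rminus_diag, Rabs_R0 in Hc1, Hc2, Hc3.
specialize (Hc1 Hd1); specialize (Hc2 Hd2); specialize (Hc3 Hd3).
apply Rabs_def2 in Hc1; apply Rabs_def2 in Hc2; apply Rabs_def2 in Hc3.
pose proof (flat_pmax s' Hs') as HQ; set (Q := pmax h a s') in *.
apply Rabs_def1.
- destruct (Rlt_le_dec (Q - P) eps) as [H|H]; [exact H|].
  pose proof (ham_qc_between s' P (P + eps) Q Hs' ltac:(lra)) as H1.
  assert (Rmax (h s' P) (h s' Q) < a + e) by (apply Rmax_lub_lt; lra); lra.
- destruct (Rlt_le_dec (- eps) (Q - P)) as [H|H]; [exact H|].
  pose proof (ham_qc_between s' Q (P - eps) P Hs' ltac:(lra)) as H1.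
  assert (Rmax (h s' Q) (h s' P) < a + e) by (apply Rmax_lub_lt; lra); lra.
Qed.

End Flat.

(** * Viscosity subsolutions and admissible levels *)

(* Penalizing by a steep parabola centred at [s0] forces [u] to have a smooth
   upper test function within distance [r] of [s0]. *)
Lemma visc_subsol_touching a u s0 r : cont01 u -> visc_subsol h a u ->
  0 < r -> 0 < s0 - r -> s0 + r < 1 ->
  exists s p, s0 - r < s < s0 + r /\ h s p <= a.
Proof.
intros Hu Hsub Hr Hl Hr'.
destruct (continuity_ab_maj (fun s => u (clamp s)) (s0 - r) (s0 + r)) as [x [Hx _]];
  [lra | intros; now apply cont01_clamp|].
pose (M := u (clamp x) - u (clamp s0)).
assert (HM : 0 <= M) by (unfold M; specialize (Hx s0 ltac:(lra)); simpl in Hx; lra).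
assert (Hr2 : 0 < r * r) by nra.
(* The penalty at both ends is [M + 1], more than the largest gain [M] of [u] over its value at
   [s0], so the maximum is interior. *)
pose (K := (M + 1) / (r * r)).
assert (HK : K * (r * r) = M + 1) by (unfold K; field; lra).
pose (phi := fun s => K * ((s - s0) * (s - s0))).
destruct (continuity_ab_maj (fun s => u (clamp s) - phi s) (s0 - r) (s0 + r))
  as [s [Hs Hsr]]; [lra| |].
{ intros z _; apply continuity_pt_minus; [now apply cont01_clamp|].
  unfold phi; reg. }
assert (Hs' : s0 - r < s < s0 + r).
{ pose proof (Hs s0 ltac:(lra)) as H0; pose proof (Hx s Hsr) as H1; simpl in H0, H1.
  unfold phi in H0; rewrite Rminus_diag in H0.
  assert (H2 : (s - s0) * (s - s0) <> r * r).
  { intros E; rewrite E in H0; unfold M in HK; nra. }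
  split; apply Rnot_le_lt; intros H3; apply H2.
  - replace s with (s0 - r) by lra; ring.
  - replace s with (s0 + r) by lra; ring. }
exists s, (2 * K * (s - s0)); split; [exact Hs'|].
apply (Hsub s ltac:(lra) phi (fun s => 2 * K * (s - s0))).
- intros z; apply is_derive_Reals; unfold phi; auto_derive; [exact I|ring].
- reg.
- exists (Rmin (s - (s0 - r)) (s0 + r - s)); split; [apply Rmin_pos; lra|].
  intros y Hy Hys.
  pose proof (Rmin_l (s - (s0 - r)) (s0 + r - s)).
  pose proof (Rmin_r (s - (s0 - r)) (s0 + r - s)).
  apply Rabs_def2 in Hys.
  specialize (Hs y ltac:(lra)); simpl in Hs.
  rewrite !clamp_id in Hs by (unfold in01; lra); exact Hs.
Qed.

(** If [b < a], then [h > b] near a parameter where the minimum is [a]: by uniform continuity for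
    bounded [p], by coercivity for the rest. A touching point there is a contradiction. *)
Lemma a_gamma_le_c_gamma_admissible a b : is_a_gamma h a -> c_gamma_admissible h b ->
  a <= b.
Proof.
intros [[s0 [Hs0 [_ Hmin]]] _] [u [Hu [_ Hsub]]].
apply Rnot_lt_le; intros Hab.
destruct (h_coer b) as [Rad HRad].
destruct (uniform_continuity_2d (fun s p => h (clamp s) p) 0 1 (- Rad) Rad) with
  (eps := mkposreal (a - b) ltac:(lra)) as [d Hd].
{ intros s p _ _ e.
  destruct (h_cont (clamp s) p (clamp_in01 s) e (cond_pos e)) as [d [Hd H]].
  exists (mkposreal d Hd); intros s' p' Hs' Hp'; apply H; [apply clamp_in01| |exact Hp'].
  apply Rle_lt_trans with (1 := clamp_lipschitz s s'), Hs'. }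
simpl in Hd.
pose (r := Rmin (d / 4) (1 / 8)).
assert (Hr0 : 0 < r) by (apply Rmin_pos; [pose proof (cond_pos d)|]; lra).
assert (Hr1 : r <= d / 4) by apply Rmin_l.
assert (Hr2 : r <= 1 / 8) by apply Rmin_r.
(* [s0] may be an end of [[0,1]], so the touching interval is moved inside; its points stay within
   [3 * r < d] of [s0]. *)
assert (Hs1 : exists s1, 0 < s1 - r /\ s1 + r < 1 /\ Rabs (s1 - s0) <= 2 * r).
{ unfold in01 in Hs0; destruct (Rle_lt_dec s0 (1 / 2)).
  - exists (s0 + 3 / 2 * r); split; [lra|]; split; [lra|]; rewrite Rabs_right; lra.
  - exists (s0 - 3 / 2 * r); split; [lra|]; split; [lra|]; rewrite Rabs_left; lra. }
destruct Hs1 as [s1 [Hs1 [Hs1' Hs10]]].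
destruct (visc_subsol_touching b u s1 r Hu Hsub Hr0 Hs1 Hs1') as [s [p [Hs Hp]]].
assert (Hs01 : in01 s) by (unfold in01; lra).
assert (HpR : - Rad <= p <= Rad).
{ apply Rabs_le_between; destruct (Rle_lt_dec (Rabs p) Rad) as [H|H]; [exact H|].
  specialize (HRad s p Hs01 H); lra. }
assert (Hdist : Rabs (s0 - s) < d).
{ revert Hs10; unfold Rabs; repeat destruct (Rcase_abs _); lra. }
pose proof (Hd s p s0 p Hs01 HpR Hs0 HpR Hdist) as H.
rewrite Rminus_diag, Rabs_R0, !clamp_id in H by assumption.
specialize (H (cond_pos d)); apply Rabs_def2 in H; specialize (Hmin p); lra.
Qed.

End Hamiltonian.

(** * Reversal of an arc *)

Section Inversion.

Variables h h' : R -> R -> R.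
Hypothesis h_cont : ham_continuous h.
Hypothesis h_coer : ham_coercive h.
Hypothesis h_qc : ham_quasiconvex h.
Hypothesis h_int : ham_interior_cond h.
Hypothesis h'_cont : ham_continuous h'.
Hypothesis h'_coer : ham_coercive h'.
Hypothesis h'_qc : ham_quasiconvex h'.
Hypothesis h'_int : ham_interior_cond h'.
Hypothesis h'_inv : forall s p, h' s p = h (1 - s) (- p).

Lemma inverted_value s p : h (1 - s) (- p) = h' s p.
Proof. now rewrite h'_inv. Qed.

(** Reversal sends the unique minimizer to its negative at the reflected parameter, so the integrals
    cancel. *)
Lemma flat_int01_pmax_inv a : (forall s, in01 s -> is_min_p h s a) ->
  int01 (pmax h a) + int01 (pmax h' a) = 0.
Proof.
intros Hflat.
pose proof (flat_pmax_cont01 h h_cont h_coer h_qc h_int a Hflat) as Hc.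
rewrite <- (int01_ext (fun s => - pmax h a (1 - s)) (pmax h' a)).
- rewrite int01_opp_reflect by exact Hc; ring.
- now apply cont01_opp_reflect.
- intros s Hs; assert (Hs' : in01 (1 - s)) by (unfold in01 in *; lra).
  enough (pmax h a (1 - s) = - pmax h' a s) by lra.
  apply (flat_minimizer_unique h h_cont h_coer h_qc h_int a Hflat (1 - s)); [exact Hs'| |].
  + now apply flat_pmax.
  + rewrite inverted_value.
    destruct (proj1 (Hflat _ Hs')) as [p Hp].
    apply (pmax_spec h' h'_cont h'_coer a s (- p) Hs).
    rewrite h'_inv, Ropp_involutive; lra.
Qed.

(* The derivative of the subsolution is the convex combination of the largest
   and the smallest root of [h s p = a] that has zero mean. *)
Lemma loop_subsolution a : (forall s, in01 s -> exists p, h s p < a) ->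
  0 < int01 (pmax h a) -> 0 < int01 (pmax h' a) -> c_gamma_admissible h a.
Proof.
intros Ha HA HB.
assert (Ha' : forall s, in01 s -> exists p, h' s p < a).
{ intros s Hs; destruct (Ha (1 - s)) as [p Hp]; [unfold in01 in *; lra|].
  exists (- p); now rewrite h'_inv, Ropp_involutive. }
pose proof (pmax_cont01 h h_cont h_coer h_qc h_int a Ha) as Hc.
pose proof (pmax_cont01 h' h'_cont h'_coer h'_qc h'_int a Ha') as Hc'.
set (A := int01 (pmax h a)) in *; set (B := int01 (pmax h' a)) in *.
pose (f := pmax h a); pose (g := fun s => - pmax h' a (1 - s)).
pose proof (cont01_opp_reflect _ Hc') as Hg; fold g in Hg.
assert (Hroot : forall s, in01 s -> h s (f s) = a /\ h s (g s) = a).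
{ intros s Hs; split.
  - destruct (Ha s Hs) as [p Hp].
    apply (pmax_spec h h_cont h_coer a s p Hs); lra.
  - assert (Hs' : in01 (1 - s)) by (unfold in01 in *; lra).
    destruct (Ha' _ Hs') as [p Hp].
    unfold g; replace s with (1 - (1 - s)) at 1 by ring; rewrite inverted_value.
    apply (pmax_spec h' h'_cont h'_coer a (1 - s) p Hs'); lra. }
(* [f] has mean [A] and [g] has mean [- B], so this weight solves [l * A = (1 - l) * B]; positivity
   of both keeps it in [[0,1]]. *)
pose (l := B / (A + B)).
assert (Hl : 0 <= l <= 1).
{ unfold l; split; [apply Rlt_le, Rdiv_lt_0_compat; lra|].
  apply Rmult_le_reg_r with (A + B); [lra|]; field_simplify; lra. }
pose (q := fun s => l * f (clamp s) + (1 - l) * g (clamp s)).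
assert (Hq : forall s, continuity_pt q s).
{ intros s; unfold q; apply continuity_pt_plus; apply continuity_pt_mult;
    try (now apply continuity_pt_const); now apply cont01_clamp. }
assert (Hqex : forall x y, ex_RInt q x y).
{ intros x y; apply (ex_RInt_continuous (V := R_CompleteNormedModule)); intros z _.
  now apply continuity_pt_filterlim. }
pose (u := fun s => RInt q 0 s).
assert (Hu : forall s, derivable_pt_lim u s (q s)).
{ intros s; apply is_derive_Reals.
  apply (is_derive_RInt (V := R_NormedModule) q u 0 s).
  - exists (mkposreal 1 Rlt_0_1); intros y _.
    apply (RInt_correct (V := R_CompleteNormedModule)), Hqex.
  - now apply continuity_pt_filterlim. }
exists u; repeat split.
- intros s _ eps Heps.
  assert (Hcs : continuity_pt u s) by (exact (derivable_continuous_pt _ _ (exist _ (q s) (Hu s)))).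
  apply continuity_pt_locally with (eps := mkposreal eps Heps) in Hcs.
  destruct Hcs as [d Hd]; exists d; split; [apply cond_pos|].
  intros s' _ Hs'; now apply Hd.
- unfold u; rewrite RInt_point.
  assert (HI : RInt q 0 1 = plus (scal l (RInt (fun s => f (clamp s)) 0 1))
    (scal (1 - l) (RInt (fun s => g (clamp s)) 0 1))).
  { rewrite <- !(RInt_scal (V := R_CompleteNormedModule)) by (now apply ex_RInt_clamp).
    rewrite <- (RInt_plus (V := R_CompleteNormedModule)).
    - reflexivity.
    - apply (ex_RInt_scal (V := R_NormedModule)); now apply ex_RInt_clamp.
    - apply (ex_RInt_scal (V := R_NormedModule)); now apply ex_RInt_clamp. }
  rewrite HI, <- !int01_clamp by assumption.
  unfold g; rewrite int01_opp_reflect by exact Hc'.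
  fold A B in HI |- *; unfold plus, scal, zero; simpl; unfold mult; simpl.
  unfold f; fold A; unfold l; field; lra.
(* [u] is C^1, so a test function touching from above has slope [q s]; quasiconvexity between the
   two roots gives the bound. *)
- intros s Hs phi dphi Hphi _ [d [Hd Hmax]].
  assert (Hs01 : in01 s) by (unfold in01; lra).
  assert (Hdiff : derivable_pt_lim (fun y => u y - phi y) s (q s - dphi s))
    by (apply derivable_pt_lim_minus; auto).
  assert (Hz : q s - dphi s = 0).
  { pose proof (Rmin_l d (Rmin s (1 - s))); pose proof (Rmin_r d (Rmin s (1 - s))).
    pose proof (Rmin_l s (1 - s)); pose proof (Rmin_r s (1 - s)).
    assert (0 < Rmin d (Rmin s (1 - s))) by (repeat apply Rmin_pos; lra).
    apply (deriv_maximum (fun y => u y - phi y) (s - Rmin d (Rmin s (1 - s)))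
      (s + Rmin d (Rmin s (1 - s))) s (exist _ _ Hdiff)); [lra|lra|].
    intros y Hy1 Hy2; apply Hmax; [lra|apply Rabs_def1; lra]. }
  replace (dphi s) with (q s) by lra.
  unfold q; rewrite clamp_id by exact Hs01.
  apply Rle_trans with (1 := h_qc s (f s) (g s) l Hs01 Hl).
  destruct (Hroot s Hs01) as [-> ->]; apply Rmax_lub; lra.
Qed.

End Inversion.

(** * Subsolutions on a finite weighted graph *)

Section Graph.

Variables (V E : Type) (o t : E -> V).
Variable w : E -> R.

Definition subsolution (u : V -> R) : Prop := forall e, u (t e) - u (o e) <= w e.

Definition always_tight (y : V) : Prop :=
  forall u, subsolution u -> exists e, t e = y /\ u (t e) - u (o e) = w e.

(** Slack on an edge survives averaging with any subsolution, so the vertices can be treated one by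
    one; every edge ends at some vertex. *)
Lemma strict_subsolution : finite_type V -> (exists u, subsolution u) ->
  (forall y, ~ always_tight y) ->
  exists u, forall e, u (t e) - u (o e) < w e.
Proof.
intros [vs Hvs] Hu Hnot.
enough (H : exists u, subsolution u /\ forall e, In (t e) vs -> u (t e) - u (o e) < w e).
{ destruct H as [u [_ H]]; exists u; auto. }
clear Hvs; induction vs as [|y vs IH].
- destruct Hu as [u Hu]; exists u; split; [exact Hu|]; intros e [].
- destruct IH as [u [Hu1 Hu2]].
  assert (Hy : exists v, subsolution v /\ forall e, t e = y -> v (t e) - v (o e) < w e).
  { apply NNPP; intros Hn; apply (Hnot y); intros v Hv; apply NNPP; intros Hn'.
    apply Hn; exists v; split; [exact Hv|]; intros e He.
    destruct (Hv e) as [H|H]; [exact H|]; contradict Hn'; now exists e. }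
  destruct Hy as [v [Hv1 Hv2]].
  exists (fun x => (u x + v x) / 2); split.
  + intros e; specialize (Hu1 e); specialize (Hv1 e); lra.
  + intros e He; specialize (Hu1 e); specialize (Hv1 e).
    destruct He as [He|He]; [specialize (Hv2 e (eq_sym He)) | specialize (Hu2 e He)]; lra.
Qed.

(** Summing the inequalities along a path gives the bound that makes the intrinsic distance
    finite. *)
Lemma subsolution_bound x y :
  clos_refl_trans V (fun a b => exists e, o e = a /\ t e = b) y x ->
  exists M, forall u, subsolution u -> u x - u y <= M.
Proof.
induction 1 as [a b [e [<- <-]]|a|a b c' _ [M1 H1] _ [M2 H2]].
- exists (w e); intros u Hu; apply Hu.
- exists 0; intros u _; lra.
- exists (M1 + M2); intros u Hu; specialize (H1 u Hu); specialize (H2 u Hu); lra.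
Qed.

Lemma finite_positive_bound {A : Type} (l : list A) (P : A -> R -> Prop) :
  (forall a d d', P a d -> 0 < d' <= d -> P a d') ->
  (forall a, exists d, 0 < d /\ P a d) ->
  exists d, 0 < d /\ forall a, In a l -> P a d.
Proof.
intros Hmono Hex; induction l as [|a l [d [Hd IH]]].
- exists 1; split; [lra|]; intros a [].
- destruct (Hex a) as [d' [Hd' Ha]].
  exists (Rmin d d'); split; [now apply Rmin_pos|].
  pose proof (Rmin_l d d'); pose proof (Rmin_r d d').
  assert (0 < Rmin d d') by now apply Rmin_pos.
  intros b [<-|Hb]; [apply Hmono with d'|apply Hmono with d]; auto.
Qed.

(* [D x] is the intrinsic distance from [y]; where no incoming edge is tight it
   could be raised at [x] and stay a subsolution, against maximality. *)
Lemma tight_subsolution y : finite_type E ->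
  (forall x z : V, clos_refl_trans V (fun a b => exists e, o e = a /\ t e = b) x z) ->
  (exists u, subsolution u) -> always_tight y ->
  exists D, subsolution D /\ forall x, exists e, t e = x /\ D (t e) - D (o e) = w e.
Proof.
intros [es Hes] Hconn [u0 Hu0] Hy.
assert (Hlub : forall x, exists d, is_lub (fun r => exists u, subsolution u /\ r = u x - u y) d).
{ intros x.
  destruct (completeness (fun r => exists u, subsolution u /\ r = u x - u y)) as [d Hd].
  - destruct (subsolution_bound x y (Hconn y x)) as [M HM]; exists M.
    intros r [u [Hu ->]]; now apply HM.
  - now exists (u0 x - u0 y), u0.
  - now exists d. }
pose (D := fun x => proj1_sig (constructive_indefinite_description _ (Hlub x))).
assert (HD : forall x, is_lub (fun r => exists u, subsolution u /\ r = u x - u y) (D x)).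
{ intros x; unfold D; now destruct (constructive_indefinite_description _ (Hlub x)). }
clearbody D.
assert (HDub : forall u x, subsolution u -> u x - u y <= D x).
{ intros u x Hu; apply (HD x); now exists u. }
assert (HDsub : subsolution D).
{ intros e; enough (D (t e) <= w e + D (o e)) by lra.
  apply (HD (t e)); intros r [u [Hu ->]].
  specialize (HDub u (o e) Hu); specialize (Hu e); lra. }
assert (HDy : D y = 0).
{ apply Rle_antisym; [|specialize (HDub u0 y Hu0); lra].
  apply (HD y); intros r [u [Hu ->]]; lra. }
exists D; split; [exact HDsub|]; intros x.
destruct (classic (x = y)) as [->|Hxy]; [exact (Hy D HDsub)|].
apply NNPP; intros Hn.
destruct (finite_positive_bound es (fun e d => t e = x -> D (t e) - D (o e) + d <= w e))
  as [d [Hd Hslack]].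
{ intros e d d' H Hd' He; specialize (H He); lra. }
{ intros e; destruct (HDsub e) as [H|H].
  - exists (w e - (D (t e) - D (o e))); split; [lra|]; intros _; lra.
  - exists 1; split; [lra|]; intros He; contradict Hn; now exists e. }
pose (D' := fun z => if excluded_middle_informative (z = x) then D z + d else D z).
assert (HD' : subsolution D').
{ intros e; pose proof (HDsub e); specialize (Hslack e (Hes e)); unfold D'.
  (* Raising the value at [x] tightens only edges entering [x] from another vertex; a loop at [x]
     keeps its difference. *)
  destruct (excluded_middle_informative (t e = x)) as [Ht|_];
    destruct (excluded_middle_informative (o e = x)) as [Ho|_]; try lra.
  specialize (Hslack Ht); lra. }
(* As [y <> x], the raised function still vanishes at [y], so maximality would give
   [D x + d <= D x]. *)
specialize (HDub D' x HD'); unfold D' in HDub.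
destruct (excluded_middle_informative (x = x)) as [_|H]; [|now contradict H].
destruct (excluded_middle_informative (y = x)) as [H|_]; [now contradict Hxy|lra].
Qed.

End Graph.

(** * Tight vertices at the critical level *)

Theorem theorem6p18
  (V E : Type) (o t : E -> V) (opp : E -> E)
  (Hgraph : graph_data V E o t opp)
  (H : E -> R -> R -> R)
  (Hinv : forall e s p, H (opp e) s p = H e (1 - s) (- p))
  (Hcont : forall e, ham_continuous (H e))
  (Hcoer : forall e, ham_coercive (H e))
  (Hqc : forall e, ham_quasiconvex (H e))
  (Hint : forall e, ham_interior_cond (H e))
  (ag cg : E -> R)
  (Hag : forall e, is_a_gamma (H e) (ag e))
  (Hcg : forall e, closed_edge o t e -> is_c_gamma (H e) (cg e))
  (a0 : R)
  (Ha0 : (forall e, (~ closed_edge o t e -> ag e <= a0) /\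
                    (closed_edge o t e -> cg e <= a0)) /\
         (exists e, (~ closed_edge o t e /\ ag e = a0) \/
                    (closed_edge o t e /\ cg e = a0)))
  (Hflat : forall e, ag e = a0 ->
     forall s s' m m', in01 s -> in01 s' ->
       is_min_p (H e) s m -> is_min_p (H e) s' m' -> m = m')
  (c : R)
  (Hc : a0 <= c /\ (exists u, DFE_subsol o t H c u) /\
        (forall a, a0 <= a -> (exists u, DFE_subsol o t H a u) -> c <= a)) :
  exists u : V -> R, DFE_sol o t opp H c u.
Proof.
destruct Hgraph as [HV [HE [Hopp [_ [Ho [_ Hconn]]]]]].
destruct Hc as [Hac [Hsub Hmin]].
destruct Ha0 as [Hle [e0 He0]].
assert (Hsigma : forall e eps, ag e < c -> eps > 0 -> exists d, d > 0 /\
  forall a, Rabs (a - c) < d -> Rabs (Defs.sigma H a e - Defs.sigma H c e) < eps).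
{ intros e eps He Heps.
  apply (int01_pmax_continuous (H e) (Hcont e) (Hcoer e) (Hqc e) (Hint e) (ag e)); auto.
  intros s Hs; destruct (ham_min_exists _ (Hcont e) (Hcoer e) s Hs) as [m Hm].
  pose proof (proj2 (Hag e) s m Hs Hm); destruct Hm as [[p Hp] _].
  exists p; lra. }
(* On loops [a0] directly bounds only [cg]; this comparison extends [ag e <= a0] to every edge. *)
assert (Hagcg : forall e, closed_edge o t e -> ag e <= cg e).
{ intros e He; apply (a_gamma_le_c_gamma_admissible (H e)); auto.
  apply (Hcg e He). }
assert (Hag0 : forall e, ag e <= a0).
{ intros e; destruct (classic (closed_edge o t e)) as [He|He].
  - apply Rle_trans with (1 := Hagcg e He), Hle, He.
  - apply Hle, He. }
assert (Hto : forall e, t (opp e) = o e) by (intros e; now rewrite <- Ho, Hopp).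
assert (Htight : exists y, always_tight V E o t (Defs.sigma H c) y).
{ destruct Hac as [Hac|Hac].
  - apply NNPP; intros Hn.
    destruct (strict_subsolution V E o t (Defs.sigma H c) HV Hsub) as [u Hu].
    { intros y Hy; apply Hn; now exists y. }
    destruct HE as [es Hes].
    destruct (finite_positive_bound es (fun e d => forall a, Rabs (a - c) < d ->
      u (t e) - u (o e) <= Defs.sigma H a e)) as [d [Hd Hsig]].
    { intros e d d' Hd Hdd a Ha; apply Hd; lra. }
    { intros e; pose proof (Hag0 e).
      destruct (Hsigma e (Defs.sigma H c e - (u (t e) - u (o e)))) as [d [Hd Hsig]];
        [lra|specialize (Hu e); lra|].
      exists d; split; [exact Hd|]; intros a Ha.
      specialize (Hsig a Ha); apply Rabs_def2 in Hsig; lra. }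
    (* The lowered level stays at least [a0] and within the tolerance [d] of [c]. *)
    pose proof (Rmin_l (d / 2) (c - a0)); pose proof (Rmin_r (d / 2) (c - a0)).
    assert (0 < Rmin (d / 2) (c - a0)) by (apply Rmin_pos; lra).
    assert (c <= c - Rmin (d / 2) (c - a0)); [|lra].
    apply Hmin; [lra|]; exists u; intros e; apply Hsig; auto.
    apply Rabs_def1; lra.
  (* Two reasons for tightness at [t e]: opposite inequalities whose weights sum to zero are both
     equalities, and on a loop of weight zero the inequality reads [0 <= 0]. *)
  - enough (Hz : exists e, Defs.sigma H c e + Defs.sigma H c (opp e) = 0 \/
      (closed_edge o t e /\ Defs.sigma H c e = 0)).
    { destruct Hz as [e [He|[He1 He2]]]; exists (t e); intros u Hu; exists e;
        (split; [reflexivity|]).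
      - pose proof (Hu e); pose proof (Hu (opp e)) as Hu'.
        rewrite Ho, Hto in Hu'; lra.
      - rewrite He1, He2; ring. }
    destruct (classic (ag e0 = a0)) as [Hag0e|Hag0e].
    + exists e0; left; rewrite <- Hac.
      apply (flat_int01_pmax_inv (H e0) (H (opp e0))); auto.
      intros s Hs; destruct (proj1 (Hag e0)) as [s1 [Hs1 Hm1]].
      destruct (ham_min_exists _ (Hcont e0) (Hcoer e0) s Hs) as [m Hm].
      rewrite Hag0e in Hm1.
      now rewrite (Hflat e0 Hag0e s1 s a0 m Hs1 Hs Hm1 Hm).
    + destruct He0 as [[_ He0]|[He0 Hcg0]]; [contradiction|].
      assert (He0' : closed_edge o t (opp e0)).
      { unfold closed_edge; now rewrite Ho, Hto. }
      destruct Hsub as [u Hu].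
      (* On a loop the subsolution inequality says that the weight is nonnegative: one orientation
         has weight zero, or both weights are positive. *)
      pose proof (Hu e0) as H1; pose proof (Hu (opp e0)) as H2.
      rewrite He0, Rminus_diag in H1; rewrite He0', Rminus_diag in H2.
      destruct H1 as [H1|H1]; [|exists e0; right; now split].
      destruct H2 as [H2|H2]; [|exists (opp e0); right; now split].
      exfalso.
      assert (Hag1 : ag e0 < c) by (pose proof (Hag0 e0); lra).
      assert (Hag2 : ag (opp e0) < c).
      { destruct (proj1 (Hag (opp e0))) as [s [Hs [[p Hp] Hm]]].
        enough (ag (opp e0) <= ag e0) by lra.
        apply (proj2 (Hag e0) (1 - s)); [unfold in01 in *; lra|]; split.
        - exists (- p); now rewrite <- Hinv.
        - intros q; rewrite <- (Ropp_involutive q), <- Hinv; apply Hm. }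
      destruct (Hsigma e0 (Defs.sigma H c e0) Hag1 H1) as [d1 [Hd1 Hs1]].
      destruct (Hsigma (opp e0) (Defs.sigma H c (opp e0)) Hag2 H2) as [d2 [Hd2 Hs2]].
      (* Half the margin keeps both integrals positive and [b] above all minima on the loop; [b] is
         then admissible although [b < cg e0]. *)
      pose (b := c - Rmin (Rmin d1 d2) (c - ag e0) / 2).
      pose proof (Rmin_l (Rmin d1 d2) (c - ag e0)).
      pose proof (Rmin_r (Rmin d1 d2) (c - ag e0)).
      pose proof (Rmin_l d1 d2); pose proof (Rmin_r d1 d2).
      assert (0 < Rmin (Rmin d1 d2) (c - ag e0)) by (repeat apply Rmin_pos; lra).
      assert (cg e0 <= b); [|unfold b in *; lra].
      apply (Hcg e0 He0), (loop_subsolution (H e0) (H (opp e0))); auto.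
      * intros s Hs; destruct (ham_min_exists _ (Hcont e0) (Hcoer e0) s Hs) as [m Hm].
        pose proof (proj2 (Hag e0) s m Hs Hm); destruct Hm as [[p Hp] _].
        exists p; unfold b; lra.
      * specialize (Hs1 b ltac:(apply Rabs_def1; unfold b; lra)).
        apply Rabs_def2 in Hs1; change (0 < Defs.sigma H b e0); lra.
      * specialize (Hs2 b ltac:(apply Rabs_def1; unfold b; lra)).
        apply Rabs_def2 in Hs2; change (0 < Defs.sigma H b (opp e0)); lra. }
destruct Htight as [y Hy].
destruct (tight_subsolution V E o t (Defs.sigma H c) y HE Hconn Hsub Hy) as [D [HD1 HD2]].
(* A tight edge entering [x], once reversed, is the outgoing edge attaining the minimum. *)
exists D; intros x; split.
- destruct (HD2 x) as [e [<- He]]; exists (opp e).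
  rewrite Ho, Hto, Hopp; split; [reflexivity|lra].
- intros e <-; specialize (HD1 (opp e)); rewrite Ho, Hto in HD1; lra.
Qed.
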